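(* Let $U$ be a Banach space with dual $U'$, and let $F,G\colon U\to\mathbb{R}$ be functionals of class $C^1$, i.e. everywhere Fréchet-differentiable with continuous differentials $\nabla F,\nabla G\colon U\to U'$. For $\alpha\in[0,+\infty)$ let $H_\alpha:=F+\alpha G$. Assume that $H_\alpha$ satisfies the local Łojasiewicz inequality, i.e., for every $\alpha\in[0,+\infty)$ and every $u\in U$ there exist an open neighborhood $\mathcal{O}_u\ni u$ and constants $C_u>0$ and $\theta_u\in(1,2]$ such that $$|H_\alpha(v)-H_\alpha(u)|\leq C_u\|\nabla H_\alpha(v)\|^{\theta_u}\qquad\text{for every }v\in\mathcal{O}_u.$$ Finally, let $K\subset U$ be a strongly compact set. Then, for all but at most countably many $\alpha\in[0,+\infty)$, the following holds: if $u_1,u_2\in K$ are such that $\nabla H_\alpha(u_1)=\nabla H_\alpha(u_2)=0$ and $H_\alpha(u_1)=H_\alpha(u_2)$, then $G(u_1)=G(u_2)$.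
   Context: The space $U$ is equipped with its strong (norm) topology; all topological notions (open neighborhood, continuity, compactness) refer to it. The neighborhood $\mathcal{O}_u$ and constants $C_u,\theta_u$ may depend on $\alpha$ as well as on $u$. $\|\nabla H_\alpha(v)\|$ denotes the dual norm in $U'$. *)

(* Defs.v *)
From mathcomp Require Export all_boot all_order all_algebra.
From mathcomp Require Export all_classical all_reals all_analysis.

Set Implicit Arguments.
Unset Strict Implicit.
Unset Printing Implicit Defensive.

Export Order.TTheory GRing.Theory Num.Theory.
Export numFieldNormedType.Exports.

Local Open Scope classical_set_scope.
Local Open Scope ring_scope.

(* The norm of the dual space U'. The real-valued [sup] is the true supremum
   when [f] is a continuous linear form; it is junk for unbounded [f]. *)
Definition dual_norm {R : realType} {U : normedModType R} (f : U -> R) : R :=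
  sup [set `|f x| | x in [set x : U | `|x| <= 1]].

(* The differential is continuous from U to U' for the dual norm, not merely
   pointwise (weakly star) continuous. *)
Definition classC1 {R : realType} {U : normedModType R} (F : U -> R) : Prop :=
  (forall u : U, differentiable F u) /\
  (forall u : U, dual_norm ('d F v \- 'd F u) @[v --> u] --> (0 : R)).

Definition local_lojasiewicz {R : realType} {U : normedModType R}
    (H : U -> R) : Prop :=
  forall u : U, exists (O : set U) (C theta : R),
    [/\ open O, O u, 0 < C, 1 < theta <= 2 &
        forall v : U, O v -> `|H v - H u| <= C * (dual_norm ('d H v) `^ theta)].

Definition Hfun {R : realType} {U : normedModType R} (F G : U -> R) (alpha : R)
  : U -> R := fun u => F u + alpha * G u.

(* Main.v *)
(* If the exceptional set were uncountable, so would be the set of triples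
   (alpha, u1, u2) witnessing it; since K is compact, one such triple would be
   a limit of triples (beta, w1, w2) with beta <> alpha.  As
   grad H_beta (w_i) = 0, grad H_alpha (w_i) = (alpha - beta) grad G (w_i), so
   the Lojasiewicz inequality at (alpha, u_i), whose exponent exceeds 1, gives
   H_alpha (w_i) = H_alpha (u_i) + o(beta - alpha).  But
   H_alpha (w1) - H_alpha (w2) = (alpha - beta) (G w1 - G w2), whence
   G w1 - G w2 -> 0 and G u1 = G u2, a contradiction. *)
Require Import Defs.
From mathcomp Require Import finmap lra ring.

Set Implicit Arguments.
Unset Strict Implicit.
Unset Printing Implicit Defensive.

Local Open Scope classical_set_scope.
Local Open Scope ring_scope.

Lemma finite_is_subset1 (T : Type) (A : set T) : is_subset1 A -> finite_set A.
Proof.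
move=> A1; have [->//|/set0P[x Ax]] := eqVneq A set0.
by apply: sub_finite_set (finite_set1 x) => y Ay; exact: A1.
Qed.

(** Sort the indices by how isolated they are: by compactness, only finitely many are isolated at a
    given scale. Isolation is phrased on indices, so it also forces [f] to be injective on [S]. *)
Lemma countable_isolated_in_compact (R : realType) (T : normedModType R)
    (I : Type) (S : set I) (f : I -> T) (K : set T) :
  compact K -> (forall i, S i -> K (f i)) ->
  (forall i, S i -> \forall y \near f i, forall j, S j -> f j = y -> j = i) ->
  countable S.
Proof.
move=> Kc SK Siso.
(* The radius is twice that of the covering balls below, so two members of [A n] in one such ball
   must coincide. *)
pose A n := [set i | S i /\
  forall j, S j -> ball (f i) (n.+1%:R^-1 + n.+1%:R^-1 : R) (f j) -> j = i].
have SA : S `<=` \bigcup_n A n.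
  move=> i Si; have /nbhs_ballP[e /= e0 fe] := Siso i Si.
  have [n _ /= ne] := near_infty_natSinv_lt (PosNum (divr_gt0 e0 (ltr0Sn R 1))).
  exists n => //; split=> // j Sj fij.
  apply: (fe (f j)) => //; apply: le_ball fij.
  by rewrite [leRHS]splitr ltW// ltrD ?ne /=.
apply: sub_countable (subset_card_le SA) _.
apply: bigcup_countable => // n _; apply: finite_set_countable.
have : cover_compact K by rewrite -compact_cover.
move=> /(_ T K (fun x => (ball x (n.+1%:R^-1 : R))^°)) [].
- by move=> x _; exact: open_interior.
- by move=> x Kx; exists x => //; apply: nbhsx_ballx; rewrite invr_gt0 ltr0Sn.
move=> D _ KD.
have AD : A n `<=` \bigcup_(x in [set` D])
    (A n `&` [set i | ball x (n.+1%:R^-1 : R) (f i)]).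
  move=> i Ai; have [x Dx xi] := KD _ (SK _ Ai.1).
  by exists x => //; split=> //; exact: interior_subset xi.
apply: sub_finite_set AD _; apply: bigcup_finite; first exact: finite_fset.
move=> x _; apply: finite_is_subset1 => i j [[Si Ai] /= xi] [[Sj Aj] /= xj].
by apply: Aj => //; apply: ball_triangle xi; exact: ball_sym.
Qed.

Section differential.
Context {R : realType} {U : normedModType R}.
Implicit Types (F G : U -> R) (f : {linear U -> R}).

Lemma ler_dual_norm f (x : U) : continuous f -> `|x| <= 1 ->
  `|f x| <= dual_norm f.
Proof.
move=> /linear_bounded_continuous/linear_boundedP fb x1.
apply: ub_le_sup; last by exists x.
near +oo_R => r.
exists r => _ [y /= y1 <-].
have r0 : 0 <= r by [].
apply: (le_trans (near fb r _ y)) => //.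
by rewrite -[leRHS]mulr1 ler_wpM2l.
Unshelve. all: by end_near. Qed.

Lemma dual_norm_le (f : U -> R) (M : R) :
  (forall x, `|x| <= 1 -> `|f x| <= M) -> dual_norm f <= M.
Proof.
move=> fM; apply: ge_sup; first by exists `|f 0|, 0 => //=; rewrite normr0.
by move=> _ [x /= x1 <-]; exact: fM.
Qed.

Lemma dual_norm_ge0 f : continuous f -> 0 <= dual_norm f.
Proof.
by move=> fc; apply: le_trans (ler_dual_norm fc (x := 0) _) => //; rewrite normr0.
Qed.

(** Near [u] the differential is within dual distance 1 of ['d F u], hence the bound
    [dual_norm ('d F u) + 1]. *)
Lemma classC1_near_bounded F (u : U) : classC1 F ->
  exists2 M : R, 0 < M &
    \forall v \near u, forall x : U, `|x| <= 1 -> `|'d F v x| <= M.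
Proof.
move=> [Fd Fc].
have F0 : 0 <= dual_norm ('d F u) by exact/dual_norm_ge0/diff_continuous.
exists (dual_norm ('d F u) + 1); first lra.
have /cvgrPdist_lt/(_ 1 ltr01) := Fc u; apply: filterS => v.
rewrite sub0r normrN => v1 x x1.
have dc : continuous ('d F v \- 'd F u).
  by move=> y; apply: cvgB; exact: diff_continuous.
have := ler_dual_norm dc x1; have := ler_dual_norm (diff_continuous (Fd u)) x1.
have := ler_norm (dual_norm ('d F v \- 'd F u)) => /=.
have := ler_normD ('d F v x - 'd F u x) ('d F u x); rewrite subrK.
lra.
Qed.

Lemma diff_Hfun F G (a : R) (u x : U) :
  differentiable F u -> differentiable G u ->
  'd (Hfun F G a) u x = 'd F u x + a * 'd G u x.
Proof.
move=> dF dG; have -> : Hfun F G a = F + a *: G by [].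
by rewrite diffD ?diffZ //; exact: differentiableZ.
Qed.

Lemma HfunB F G (a b : R) (u : U) :
  Hfun F G a u = Hfun F G b u + (a - b) * G u.
Proof. by rewrite /Hfun; ring. Qed.

(** This is the [o(beta - alpha)] estimate, with [k] arbitrarily small. The differential of
    [Hfun F G a] at [p.2] has dual norm at most [M * |a - p.1|], and a power [theta > 1] of it is
    negligible against [|a - p.1|]. *)
Lemma lojasiewicz_critical_near F G (a k : R) (u : U) :
  classC1 F -> classC1 G -> local_lojasiewicz (Hfun F G a) -> 0 < k ->
  \forall p \near (a, u), 'd (Hfun F G p.1) (p.2) = 0 :> (U -> R) ->
    `|Hfun F G a p.2 - Hfun F G a u| <= k * `|a - p.1|.
Proof.
move=> F1 G1 /(_ u) [V [C [theta [Vo Vu C0 /andP[t1 t2] Hloj]]]] k0.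
have [M M0 GM] := classC1_near_bounded u G1.
have [e e0 He] : exists2 e : R, 0 < e & forall s, 0 <= s -> s <= e ->
    C * s `^ theta <= k / M * s.
  have t0 : 0 < theta - 1 by lra.
  pose c := k / M / C; have c0 : 0 < c by rewrite !divr_gt0.
  (* This threshold gives [s^(theta - 1) <= c], so [C * s^theta <= C * c * s], and
     [C * c = k / M]. *)
  exists (c `^ (theta - 1)^-1); first exact: powR_gt0.
  move=> s s0 sc; rewrite -mulr_powRB1//; last lra.
  have : s `^ (theta - 1) <= c.
    apply: (@le_trans _ _ ((c `^ (theta - 1)^-1) `^ (theta - 1))).
      by rewrite ge0_ler_powR ?nnegrE ?powR_ge0// ltW.
    by rewrite -powRrM mulVf ?gt_eqF// powRr1// ltW.
  rewrite /c ler_pdivlMr// => sC.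
  have -> : C * (s * s `^ (theta - 1)) = s `^ (theta - 1) * C * s by ring.
  exact: ler_wpM2r.
have aM : \forall b \near a, `|a - b| < e / M.
  by have /cvgrPdist_lt := @cvg_id _ (nbhs a); apply; exact: divr_gt0.
have uO : \forall w \near u, V w /\ forall x : U, `|x| <= 1 -> `|'d G w x| <= M.
  by apply: filterI => //; exact: open_nbhs_nbhs.
near=> p.
have [Vp GMp] : V p.2 /\ forall x : U, `|x| <= 1 -> `|'d G (p.2) x| <= M.
  by near: p; exact: cvg_snd uO.
have ap : `|a - p.1| < e / M by near: p; exact: cvg_fst aM.
move=> dH0; apply: (le_trans (Hloj _ Vp)).
have dH x : 'd (Hfun F G a) (p.2) x = (a - p.1) * 'd G (p.2) x.
  have := congr1 (@^~ x) dH0; rewrite !diff_Hfun /=; try exact: F1.1; try exact: G1.1.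
  rewrite /GRing.zero /=.
  by move=> dp; rewrite mulrBl addrC; lra.
have dHM : dual_norm ('d (Hfun F G a) (p.2)) <= `|a - p.1| * M.
  by apply: dual_norm_le => x x1; rewrite dH normrM ler_wpM2l ?GMp.
have dH_ge0 : 0 <= dual_norm ('d (Hfun F G a) (p.2)).
  apply/dual_norm_ge0/diff_continuous.
  by apply: differentiableD; [exact: F1.1|apply: differentiableZ; exact: G1.1].
rewrite ltr_pdivlMr// in ap.
apply: le_trans (He _ dH_ge0 (le_trans dHM (ltW ap))) _.
have -> : k * `|a - p.1| = k / M * (`|a - p.1| * M).
  by field; rewrite gt_eqF.
by rewrite ler_wpM2l// divr_ge0// ltW.
Unshelve. all: by end_near. Qed.

(** Only the parameter is isolated: critical pairs may accumulate at [(u1, u2)] with [p.1 = a]. *)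
Lemma critical_value_isolated F G (a : R) (u1 u2 : U) :
  classC1 F -> classC1 G -> local_lojasiewicz (Hfun F G a) ->
  Hfun F G a u1 = Hfun F G a u2 -> G u1 <> G u2 ->
  \forall p \near (a, (u1, u2)),
    'd (Hfun F G p.1) (p.2.1) = 0 :> (U -> R) ->
    'd (Hfun F G p.1) (p.2.2) = 0 :> (U -> R) ->
    Hfun F G p.1 p.2.1 = Hfun F G p.1 p.2.2 -> p.1 = a.
Proof.
move=> F1 G1 Ha Hu Gu.
pose d := `|G u1 - G u2|.
have d0 : 0 < d by rewrite normr_gt0 subr_eq0; exact/eqP.
(* Two Lojasiewicz errors and two continuity errors of [d / 6] each will sum to [2 * d / 3 < d]. *)
have k0 : 0 < d / 6 by rewrite divr_gt0.
have G_near u : \forall q \near (a, u), `|G u - G q.2| < d / 6.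
  apply: (@cvg_snd _ _ (nbhs a) (nbhs u) _ [set w | `|G u - G w| < d / 6]).
  have Gc : G w @[w --> u] --> G u by exact/differentiable_continuous/G1.1.
  by move/cvgrPdist_lt: Gc; apply.
have near1 := lojasiewicz_critical_near u1 F1 G1 Ha k0.
have near2 := lojasiewicz_critical_near u2 F1 G1 Ha k0.
have c1 : (p.1, p.2.1) @[p --> (a, (u1, u2))] --> (a, u1).
  apply: (@cvg_pair _ _ _ _ (nbhs a) (nbhs u1)); first exact: cvg_fst.
  by apply: (@cvg_comp _ _ _ snd fst); [exact: cvg_snd|exact: cvg_fst].
have c2 : (p.1, p.2.2) @[p --> (a, (u1, u2))] --> (a, u2).
  apply: (@cvg_pair _ _ _ _ (nbhs a) (nbhs u2)); first exact: cvg_fst.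
  by apply: (@cvg_comp _ _ _ snd snd); [exact: cvg_snd|exact: cvg_snd].
have g1 : \forall p \near (a, (u1, u2)), `|G u1 - G p.2.1| < d / 6.
  exact: c1 _ (G_near u1).
have g2 : \forall p \near (a, (u1, u2)), `|G u2 - G p.2.2| < d / 6.
  exact: c2 _ (G_near u2).
near=> p => dH1 dH2 Hp; apply: contrapT => pa.
have H1 : `|Hfun F G a p.2.1 - Hfun F G a u1| <= d / 6 * `|a - p.1|.
  by move: dH1; near: p; exact: c1 _ near1.
have H2 : `|Hfun F G a p.2.2 - Hfun F G a u2| <= d / 6 * `|a - p.1|.
  by move: dH2; near: p; exact: c2 _ near2.
have Gw1 : `|G u1 - G p.2.1| < d / 6 by near: p.
have Gw2 : `|G u2 - G p.2.2| < d / 6 by near: p.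
have HG : `|a - p.1| * `|G p.2.1 - G p.2.2| <= d / 3 * `|a - p.1|.
  rewrite -normrM.
  have -> : (a - p.1) * (G p.2.1 - G p.2.2) =
      (Hfun F G a p.2.1 - Hfun F G a u1) - (Hfun F G a p.2.2 - Hfun F G a u2).
    by rewrite (HfunB F G a p.1 p.2.1) (HfunB F G a p.1 p.2.2) Hu Hp; ring.
  by apply: le_trans (ler_normB _ _) _; lra.
have ap : 0 < `|a - p.1|.
  by rewrite normr_gt0 subr_eq0; apply/eqP => /esym.
rewrite mulrC ler_pM2r// in HG.
have : d <= `|G u1 - G p.2.1| + `|G p.2.1 - G p.2.2| + `|G u2 - G p.2.2|.
  rewrite /d (distrC (G u2)).
  apply: le_trans (ler_distD (G p.2.2) _ _) _.
  by rewrite lerD2r; exact: ler_distD.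
lra.
Unshelve. all: by end_near. Qed.

End differential.

Theorem theorem5p1 (R : realType) (U : completeNormedModType R)
    (F G : U -> R) (F_C1 : classC1 F) (G_C1 : classC1 G)
    (H_loj : forall alpha : R, 0 <= alpha -> local_lojasiewicz (Hfun F G alpha))
    (K : set U) (K_compact : compact K) :
  countable [set alpha : R | 0 <= alpha /\
    ~ (forall u1 u2 : U, K u1 -> K u2 ->
         'd (Hfun F G alpha) u1 = 0 :> (U -> R) ->
         'd (Hfun F G alpha) u2 = 0 :> (U -> R) ->
         Hfun F G alpha u1 = Hfun F G alpha u2 -> G u1 = G u2)].
Proof.
set B := [set alpha | _].
pose P alpha (u : U * U) := [/\ K u.1, K u.2,
  'd (Hfun F G alpha) (u.1) = 0 :> (U -> R),
  'd (Hfun F G alpha) (u.2) = 0 :> (U -> R) &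
  Hfun F G alpha u.1 = Hfun F G alpha u.2 /\ G u.1 <> G u.2].
(* One bad pair is chosen per exceptional parameter; [(0, 0)] is a filler outside [B]. *)
have /choice[u uP] : forall alpha, exists u, B alpha -> P alpha u.
  move=> alpha; have [[a0 nG]|nB] := pselect (B alpha); last by exists (0, 0).
  apply: contrapT => /forallNP nP; apply: nG => u1 u2 Ku1 Ku2 d1 d2 H12.
  by apply: contrapT => G12; apply: (nP (u1, u2)).
(* Bounding the parameter places the triples in a compact product. *)
have BS : B `<=` \bigcup_n (B `&` `[0, n%:R]).
  move=> a Ba; exists (Num.bound a) => //; split=> //=.
  by rewrite in_itv/= Ba.1 ltW// archi_boundP// Ba.1.
apply: sub_countable (subset_card_le BS) _; apply: bigcup_countable => // n _.
apply: (@countable_isolated_in_compact R (R * (U * U))%type _ _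
  (fun a => (a, u a)) (`[0, n%:R] `*` (K `*` K))).
- by apply: compact_setX; [exact: segment_compact|exact: compact_setX].
- by move=> a [/uP[Ku1 Ku2 _ _ _] an]; split.
- move=> a [Ba _]; have [_ _ _ _ [H12 G12]] := uP _ Ba.
  have := critical_value_isolated F_C1 G_C1 (H_loj a Ba.1) H12 G12.
  rewrite -surjective_pairing; apply: filterS => p pa b [/uP[_ _ d1 d2 [Hb _]] _] bp.
  by rewrite -bp in pa; exact: pa.
Qed.
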